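(* Let $\mathbb{K}\subseteq\mathbb{L}$ be valued fields with the same value group $G$, where the valuation $v$ of $\mathbb{L}$ extends that of $\mathbb{K}$. Assume that $G$ is divisible and that the residue field of $\mathbb{K}$ is infinite. Let $f(X)\in\mathbb{L}[X]$ be any polynomial such that $v(f(a))>v(f(b))$ for some $a,b\in\mathbb{K}$, where $v(a),v(b)$ are not necessarily distinct. Then for every $\alpha\in G$ such that $v(f(a))>\alpha>v(f(b))$ there is $c\in\mathbb{K}$ such that: 1. $v(f(c))=\alpha$; 2. $\min\{v(a),v(b)\}\le v(c)\le\max\{v(a),v(b)\}$.
   Context: A valued field is a field $\mathbb{K}$ with a non-trivial (Krull) valuation, i.e. a surjective map $v:\mathbb{K}\to G\cup\{\infty\}$, with $G$ a totally ordered abelian group (of arbitrary rank) written additively, $v(x)=\infty$ iff $x=0$, $v(xy)=v(x)+v(y)$, $v(x+y)\ge\min\{v(x),v(y)\}$. Its valuation ring is $A=\{x: v(x)\ge 0\}$ with maximal ideal $M=\{x: v(x)>0\}$, and the residue field is $A/M$. The symbol $v$ is used for the valuations of both $\mathbb{K}$ and $\mathbb{L}$. No completeness, henselianity or algebraic closedness is assumed. *)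

(* Defs.v *)
From HB Require Import structures.
From mathcomp Require Import all_boot all_order all_algebra.
From mathcomp Require Import classical_sets cardinality.

Set Implicit Arguments.
Unset Strict Implicit.
Unset Printing Implicit Defensive.

Import Order.TTheory GRing.Theory.
Local Open Scope ring_scope.
Local Open Scope quotient_scope.

(* Totally ordered abelian groups: MathComp's porderZmodType imposes no
   compatibility between the order and the addition. *)
HB.mixin Record isTotallyOrderedZmodule G of Num.POrderedZmodule G := {
  ozmod_le_total : total (@Order.le ring_display G);
  ozmod_leD2l : forall z x y : G, x <= y -> z + x <= z + y
}.

#[short(type="orderedZmodType")]
HB.structure Definition OrderedZmodule :=
  { G of Num.POrderedZmodule G & isTotallyOrderedZmodule G }.

Definition divisible (G : zmodType) : Prop :=
  forall (n : nat) (g : G), (0 < n)%N -> exists h : G, h *+ n = g.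

(* The ordered commutative monoid G ∪ {∞}, where ∞ is the greatest element
   and is absorbing for the addition. *)
Definition with_infty (G : Type) : Type := option G.
Definition Fin (G : Type) (g : G) : with_infty G := Some g.
Definition Infty {G : Type} : with_infty G := None.

HB.instance Definition _ (G : choiceType) := Choice.copy (with_infty G) (option G).

Section WithInfty.
Variable G : orderedZmodType.
Implicit Types x y z : with_infty G.

Definition addi x y : with_infty G :=
  match x, y with
  | Some a, Some b => Fin (a + b)
  | _, _ => Infty
  end.

Definition lei x y : bool :=
  match x, y with
  | _, None => true
  | None, Some _ => false
  | Some a, Some b => a <= b
  end.

Fact addiA : associative addi.
Proof. by case=> [a|] [b|] [c|] //=; rewrite addrA. Qed.

Fact addiC : commutative addi.
Proof. by case=> [a|] [b|] //=; rewrite addrC. Qed.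

Fact add0i : left_id (Fin 0) addi.
Proof. by case=> [a|] //=; rewrite add0r. Qed.

Fact lei_refl : reflexive lei.
Proof. by case=> /=. Qed.

Fact lei_anti : antisymmetric lei.
Proof. by case=> [a|] [b|] //= /le_anti ->. Qed.

Fact lei_trans : transitive lei.
Proof. by case=> [a|] [b|] [c|] //=; apply: le_trans. Qed.

Fact lei_total : total lei.
Proof. by case=> [a|] [b|] //=; apply: ozmod_le_total. Qed.

HB.instance Definition _ :=
  GRing.isNmodule.Build (with_infty G) addiA addiC add0i.
HB.instance Definition _ :=
  Order.Le_isPOrder.Build ring_display (with_infty G)
    lei_refl lei_anti lei_trans.
HB.instance Definition _ :=
  Order.POrder_isTotal.Build ring_display (with_infty G) lei_total.

End WithInfty.

(* Surjectivity onto G ∪ {∞} makes G the value group. *)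
Record valuation (K : fieldType) (G : orderedZmodType) := Valuation {
  valuation_fun :> K -> with_infty G;
  valuation_surj : forall g : with_infty G, exists x : K, valuation_fun x = g;
  valuation_infty : forall x : K, valuation_fun x = Infty <-> x = 0;
  valuationM : forall x y : K,
    valuation_fun (x * y) = valuation_fun x + valuation_fun y;
  valuationD : forall x y : K,
    Order.min (valuation_fun x) (valuation_fun y) <= valuation_fun (x + y);
  valuation_nontrivial : exists x : K, x != 0 /\ valuation_fun x <> Fin 0
}.

Section ResidueField.
Variables (K : fieldType) (G : orderedZmodType) (v : valuation K G).
Implicit Types x y : K.

Fact valuation0 : v 0 = Infty.
Proof. exact/valuation_infty. Qed.

Fact valuation_eq_double (g : with_infty G) : g = g + g -> g <> Infty -> g = Fin 0.
Proof.
case: g => [g [/esym e] _|] //; congr Some.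
by apply: (addrI g); rewrite e addr0.
Qed.

Fact valuation1 : v 1 = Fin 0.
Proof.
apply: valuation_eq_double; first by rewrite -valuationM mulr1.
by move/valuation_infty/eqP; rewrite oner_eq0.
Qed.

Fact valuation_selfD_eq0 (g : with_infty G) : g + g = Fin 0 -> g = Fin 0.
Proof.
case: g => [g|] // [e]; congr Some; apply: le_anti.
have [g0|g0] := orP (ozmod_le_total g 0); rewrite g0 ?andbT /=.
  by have := ozmod_leD2l g _ _ g0; rewrite e addr0.
by have := ozmod_leD2l g _ _ g0; rewrite e addr0.
Qed.

Fact valuationN x : v (- x) = v x.
Proof.
have vN1 : v (-1) = Fin 0.
  by apply: valuation_selfD_eq0; rewrite -valuationM mulrNN mulr1 valuation1.
by rewrite -mulN1r valuationM vN1 add0r.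
Qed.

Definition valuation_ring_pred : {pred K} := fun x => Fin 0 <= v x.

Fact lei_add (a b : with_infty G) : Fin 0 <= a -> Fin 0 <= b -> Fin 0 <= a + b.
Proof.
case: a b => [a|] [b|] // a0 b0; rewrite /Order.le /= in a0 b0 *.
by apply: (le_trans a0); have := ozmod_leD2l a _ _ b0; rewrite addr0.
Qed.

Fact valuation_ring_subring : subring_closed valuation_ring_pred.
Proof.
split=> [|x y|x y]; rewrite /valuation_ring_pred !unfold_in /=.
- by rewrite valuation1.
- move=> x0 y0; apply: le_trans (valuationD v x (- y)).
  by rewrite valuationN le_min x0.
- by move=> x0 y0; rewrite valuationM lei_add.
Qed.

HB.instance Definition _ :=
  GRing.isSubringClosed.Build K valuation_ring_pred valuation_ring_subring.

Record valuation_ring := ValuationRing {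
  valuation_ring_val :> K;
  _ : valuation_ring_val \in valuation_ring_pred
}.

HB.instance Definition _ := [isSub for valuation_ring_val].
HB.instance Definition _ := [Choice of valuation_ring by <:].
HB.instance Definition _ := [SubChoice_isSubComNzRing of valuation_ring by <:].

Definition valuation_ideal : {pred valuation_ring} := fun u => Fin 0 < v (val u).

Fact lti_add (a b : with_infty G) : Fin 0 <= a -> Fin 0 < b -> Fin 0 < a + b.
Proof.
move=> a0 b0; rewrite lt_neqAle lei_add ?(ltW b0) // andbT eq_sym.
apply/eqP; case: a b a0 b0 => [a|] [b|] // a0 b0 [e].
have b0' := ltW b0; rewrite /Order.le /= in a0 b0'.
have := ozmod_leD2l a _ _ b0'; rewrite e addr0 => a0'.
have ea : a = 0 by apply: le_anti; rewrite a0 a0'.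
by move: b0; rewrite -e ea add0r ltxx.
Qed.

Fact valuation_idealr : idealr_closed valuation_ideal.
Proof.
split=> [||a u w]; rewrite !unfold_in /valuation_ideal.
- by rewrite (raddf0 val) valuation0.
- by rewrite (rmorph1 val) valuation1 ltxx.
- move=> u0 w0; rewrite (rmorphD val) (rmorphM val).
  apply: lt_le_trans (valuationD v _ _); rewrite lt_min w0 andbT valuationM.
  by apply: lti_add => //; apply: (valP a).
Qed.

HB.instance Definition _ :=
  isIdealr.Build valuation_ring valuation_ideal valuation_idealr.

Definition residue_field := {ideal_quot valuation_ideal}.
HB.instance Definition _ := GRing.ComNzRing.on residue_field.
HB.instance Definition _ := EqQuotient.on residue_field.

Definition residue_inv (r : residue_field) : residue_field :=
  if r == 0 then 0 else \pi_residue_field (insubd 0 (val (repr r))^-1).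

Fact residue_inv0 : residue_inv 0 = 0.
Proof. by rewrite /residue_inv eqxx. Qed.

Fact residue_eq0 (u : valuation_ring) :
  (\pi_residue_field u == 0) = (Fin 0 < v (val u)).
Proof.
rewrite -[RHS]/(u \in valuation_ideal) -[in RHS](subr0 u).
by rewrite Quotient.idealrBE; congr (_ == _); rewrite -(rmorph0 \pi_residue_field).
Qed.

Fact residue_mulVf (r : residue_field) : r != 0 -> residue_inv r * r = 1.
Proof.
rewrite /residue_inv => r0; rewrite (negPf r0).
have := r0; rewrite -{1}[r]reprK residue_eq0 -leNgt => vr_le0.
have vr : v (val (repr r)) = Fin 0.
  by apply: le_anti; rewrite vr_le0; apply: (valP (repr r)).
have r_neq0 : val (repr r) != 0.
  by apply/eqP => e; move: vr; rewrite e valuation0.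
have vVe : v (val (repr r))^-1 = Fin 0.
  by rewrite -valuation1 -(mulVf r_neq0) valuationM vr addrC add0r.
have vV : (val (repr r))^-1 \in valuation_ring_pred.
  by rewrite -[_ \in _]/(Fin 0 <= v _) vVe.
rewrite -{2}[r]reprK -(rmorphM \pi_residue_field) -(rmorph1 \pi_residue_field).
congr (\pi_residue_field _); apply: val_inj.
rewrite (rmorphM val) (rmorph1 val) -[RHS](mulVf r_neq0); congr (_ * _).
exact: (insubdK (0 : valuation_ring) vV).
Qed.

HB.instance Definition _ :=
  GRing.ComNzRing_isField.Build residue_field residue_mulVf residue_inv0.

End ResidueField.

(* Main.v *)
(** Restrict [f] to the segment: with [p(T) = f(a + (b - a)T)], [p(0) = f(a)]
    and [p(1) = f(b)].  For [v(t) = γ] the polynomial [p(tX)] has coefficients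
    of value [v(p_i) + iγ]; by divisibility one may choose [γ >= 0] so that the
    least of them is exactly [α].  A polynomial of degree [n] takes a value
    exceeding its least coefficient value on at most [n] residue classes, so,
    the residue field being infinite, some integral [u] satisfies
    [v(p(tu)) = α], and simultaneously [v(c) <= v(a)] where
    [c = a + (b - a)tu].  The lower bound on [v(c)] is the ultrametric
    inequality. *)
Require Import Defs.
From mathcomp Require Import all_boot all_order all_algebra finmap.
From mathcomp Require Import classical_sets cardinality.
Import Order.TTheory GRing.Theory.
Local Open Scope ring_scope.
Local Open Scope classical_set_scope.

Section OrderedGroup.
Set Implicit Arguments.
Unset Strict Implicit.
Variable G : orderedZmodType.
Implicit Types (x y z : with_infty G) (g h : G).

Lemma leiD2l z x y : x <= y -> z + x <= z + y.
Proof.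
by case: x y z => [x|] [y|] [z|] //; rewrite /Order.le /=; apply: ozmod_leD2l.
Qed.

Lemma lei_addr x y : Fin 0 <= y -> x <= x + y.
Proof. by move=> /(leiD2l x); rewrite -[X in X <= _]/(x + 0) addr0. Qed.

Lemma lei_Infty x : x <= Infty.
Proof. by case: x. Qed.

Lemma FinMn g n : Fin g *+ n = Fin (g *+ n).
Proof. by elim: n => // n IH; rewrite !mulrS IH. Qed.

Lemma leiMn n x y : x <= y -> x *+ n <= y *+ n.
Proof.
move=> xy; elim: n => [|n IH]; first by rewrite !mulr0n.
rewrite !mulrS (le_trans (leiD2l x IH)) // ![_ + y *+ n]addrC.
exact: leiD2l.
Qed.

(* [gamma] is the maximum of [0] and of the slopes [(alpha - w i) / i]; the case
   [gamma = 0] arises when every [w i] is at least [alpha]. *)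
Lemma newton_slope (w : nat -> with_infty G) (alpha : G) n : divisible G ->
  exists gamma : G,
    [/\ Fin 0 <= Fin gamma,
        forall i, (0 < i < n)%N -> Fin alpha <= w i + Fin gamma *+ i
      & gamma = 0 \/
        exists2 i, (0 < i < n)%N & w i + Fin gamma *+ i = Fin alpha].
Proof.
move=> Gdiv; elim: n => [|n [gamma [gamma0 le_alpha eq_alpha]]].
  by exists 0; split=> // [i|]; [rewrite ltn0 andbF | left].
case: (posnP n) => [n0|n_gt0].
  exists gamma; split=> // [i|]; first by rewrite n0 ltnS; case: i.
  case: eq_alpha => [|[i]]; first by left.
  by rewrite n0 ltn0 andbF.
have [le_n|lt_n] := leP (Fin alpha) (w n + Fin gamma *+ n).
  exists gamma; split=> // [i /andP[i0]|].
    rewrite ltnS leq_eqVlt => /predU1P[->//|iltn].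
    by apply: le_alpha; rewrite i0.
  case: eq_alpha => [|[i /andP[i0 iltn] e]]; first by left.
  by right; exists i; rewrite // i0 ltnS ltnW.
(* The bound fails at [n], so [w n] is finite, and divisibility provides the slope [gamma'] giving
   equality at [n]. It is at least [gamma], so the earlier bounds persist. *)
case wn : (w n) lt_n => [g|] lt_n; last by [].
have [gamma' gamma'E] := Gdiv n (alpha - g) n_gt0.
have wnE : w n + Fin gamma' *+ n = Fin alpha.
  by rewrite wn FinMn gamma'E; congr Some; rewrite addrC subrK.
have le_gamma : Fin gamma <= Fin gamma'.
  rewrite leNgt; apply/negP => /ltW/(leiMn n)/(leiD2l (w n)).
  by rewrite wnE wn leNgt lt_n.
exists gamma'; split; first exact: le_trans le_gamma.
- move=> i /andP[i0]; rewrite ltnS leq_eqVlt => /predU1P[->|iltn].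
    by rewrite wnE.
  apply: le_trans (leiD2l (w i) (leiMn i le_gamma)).
  by apply: le_alpha; rewrite i0.
- by right; exists n; rewrite // n_gt0 ltnS leqnn.
Qed.

End OrderedGroup.

Section Valuation.
Set Implicit Arguments.
Unset Strict Implicit.
Variables (K : fieldType) (G : orderedZmodType) (v : valuation K G).
Implicit Types (x y : K) (beta : with_infty G) (p : {poly K}) (us : seq K).

Lemma valuationX x n : v (x ^+ n) = v x *+ n.
Proof.
elim: n => [|n IH]; first by rewrite valuation1.
by rewrite exprS valuationM IH mulrS.
Qed.

Lemma lt_valuationD beta x y : beta < v x -> beta < v y -> beta < v (x + y).
Proof.
by move=> bx by_; apply: lt_le_trans (valuationD v x y); rewrite lt_min bx.
Qed.

Lemma lt_valuationMr beta x y : beta < v x -> Fin 0 <= v y -> beta < v (x * y).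
Proof. by move=> bx y0; rewrite valuationM (lt_le_trans bx) ?lei_addr. Qed.

Lemma le_valuation_horner beta p x : (forall i, beta <= v p`_i) ->
  Fin 0 <= v x -> beta <= v p.[x].
Proof.
move=> le_coef x0; rewrite horner_coef.
elim/big_ind: _ => [|y z by_ bz|i _]; first by rewrite valuation0 lei_Infty.
- by apply: le_trans (valuationD v y z); rewrite le_min by_.
rewrite valuationM (le_trans (le_coef i)) // lei_addr //.
have xA : x \in valuation_ring_pred v by [].
exact: (rpredX i xA).
Qed.

(* Induction by synthetic division: [p = p(x) + ('X - x) q], and [q] is large
   at the remaining points because these differ from [x] by a unit. *)
Lemma lt_valuation_coef beta us p : beta < Infty -> (size p <= size us)%N ->
    all (fun u => Fin 0 <= v u) us ->
    pairwise (fun x y => v (x - y) <= Fin 0) us ->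
    all (fun u => beta < v p.[u]) us ->
  forall i, beta < v p`_i.
Proof.
move=> beta_fin; elim: us p => [|x us IH] p /=.
  by rewrite leqn0 size_poly_eq0 => /eqP-> _ _ _ i; rewrite coef0 valuation0.
move=> sz_p /andP[x0 us0] /andP[x_us us_pw] /andP[px pus].
have /factor_theorem[q qE] : root (p - p.[x]%:P) x.
  by rewrite /root !hornerE subrr.
have pE : p = q * ('X - x%:P) + p.[x]%:P by rewrite -qE subrK.
have sz_q : (size q <= size us)%N.
  have [->|q0] := eqVneq q 0; first by rewrite size_poly0.
  have := size_Mmonic q0 (monicXsubC x).
  rewrite size_XsubC addn2 -qE /= => sz_qS.
  rewrite -ltnS -[X in (X <= _)%N]sz_qS (leq_trans (size_polyD _ _)) //.
  by rewrite geq_max sz_p size_polyN (leq_trans (size_polyC_leq1 _)).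
have {IH us0 us_pw} q_gt : forall i, beta < v q`_i.
  apply: IH => //; apply/allP => u u_us.
  have := allP pus u u_us; have := allP x_us u u_us.
  rewrite -valuationN opprB => ux_le.
  move=> pu; have : beta < v (q.[u] * (u - x)).
    have -> : q.[u] * (u - x) = p.[u] + - p.[x].
      by rewrite {1}pE !hornerE addrK.
    by apply: lt_valuationD; rewrite ?valuationN.
  (* As [v (u - x) <= Fin 0], the factor [q.[u]] has at least the value of the product. *)
  rewrite valuationM => /lt_le_trans; apply.
  by have := leiD2l (v q.[u]) ux_le; rewrite -[X in _ <= X]/(_ + 0) addr0.
move=> i; rewrite pE mulrBr !coefD coefN coefMX coefMC coefC.
have zero_gt : beta < v 0 by rewrite valuation0.
apply: lt_valuationD; last by case: ifP.
apply: lt_valuationD; first by case: ifP.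
by rewrite valuationN lt_valuationMr.
Qed.

(** With [size p] such points, [lt_valuation_coef] applied to them alone would put every coefficient
    above [beta]. *)
Lemma size_lt_valuation_horner beta us p i : beta < Infty ->
    all (fun u => Fin 0 <= v u) us ->
    pairwise (fun x y => v (x - y) <= Fin 0) us -> v p`_i <= beta ->
  (count (fun u => beta < v p.[u])%R us < size p)%N.
Proof.
move=> beta_fin us0 us_pw; rewrite ltnNge; apply: contraTN => sz_p.
rewrite -ltNge.
apply: (@lt_valuation_coef _ [seq u <- us | beta < v p.[u]]) => //.
- by rewrite size_filter.
- by apply/allP => u; rewrite mem_filter => /andP[_ /(allP us0)].
- exact: subseq_pairwise (filter_subseq _ _) us_pw.
- exact: filter_all.
Qed.

(** Lifts of distinct residue classes: their differences lie outside the maximal ideal, which is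
    what [v (x - y) <= Fin 0] expresses. *)
Lemma residue_representatives n : infinite_set [set: residue_field v] ->
  exists us : seq K, [/\ size us = n, all (fun u => Fin 0 <= v u) us
    & pairwise (fun x y => v (x - y) <= Fin 0) us].
Proof.
move=> /(infinite_set_fset n)[B _ szB].
pose lft (r : residue_field v) : K := val (repr r).
exists (map lft (take n B)); split.
- by rewrite size_map size_takel.
- by apply/allP => _ /mapP[r _ ->]; apply: (valP (repr r)).
have: uniq (take n B) by rewrite take_uniq.
rewrite pairwise_map uniq_pairwise; apply: sub_pairwise => r s rs.
rewrite /relpre /= leNgt -(rmorphB val) -residue_eq0 rmorphB /=.
by rewrite !reprK subr_eq0.
Qed.

End Valuation.

Theorem theorem2p9 (G : orderedZmodType) (K L : fieldType)
    (iota : {rmorphism K -> L}) (vK : valuation K G) (vL : valuation L G)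
    (v_ext : forall x : K, vL (iota x) = vK x)
    (G_div : divisible G)
    (res_inf : infinite_set [set: residue_field vK])
    (f : {poly L}) (a b : K) (fab : vL f.[iota b] < vL f.[iota a]) :
  forall alpha : G, vL f.[iota b] < Fin alpha < vL f.[iota a] ->
  exists c : K,
    vL f.[iota c] = Fin alpha /\
    Order.min (vK a) (vK b) <= vK c <= Order.max (vK a) (vK b).
Proof.
move=> alpha /andP[fb_lt fa_gt].
pose p := f \Po ((iota a)%:P + iota (b - a) *: 'X).
have pE x : p.[x] = f.[iota a + iota (b - a) * x].
  by rewrite horner_comp !hornerE.
have [gamma [gamma0 le_alpha eq_alpha]] :=
  newton_slope (fun i => vL p`_i) alpha (size p) G_div.
have [t vt] := valuation_surj vK (Fin gamma).
pose q := \poly_(i < size p) (p`_i * iota t ^+ i).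
have qE x : q.[x] = p.[iota t * x].
  rewrite horner_poly horner_coef; apply: eq_bigr => i _.
  by rewrite exprMn mulrA.
have vq i : (i < size p)%N -> vL q`_i = vL p`_i + Fin gamma *+ i.
  by move=> ip; rewrite coef_poly ip valuationM valuationX v_ext vt.
have le_q i : Fin alpha <= vL q`_i.
  have [ip|ip] := ltnP i (size p); last first.
    by rewrite coef_poly ltnNge ip valuation0 lei_Infty.
  (* The slope controls positive indices only; the constant coefficient of [q] is [f(a)], of value
     above [alpha]. *)
  case: (posnP i) => [i0|i_gt0]; last by rewrite vq // le_alpha ?i_gt0.
  have -> : q`_i = q.[0] by rewrite i0 horner_coef0.
  by rewrite qE mulr0 pE mulr0 addr0 ltW.
have [i le_qi] : exists i, vL q`_i <= Fin alpha.
  case: eq_alpha => [gamma_eq0|[i /andP[_ ip] e]]; last first.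
    by exists i; rewrite vq // e.
  (* The case [gamma = 0] is contradictory: all coefficients of [p] would have value at least
     [alpha], hence so would [p(1) = f(b)]. *)
  have: Fin alpha <= vL p.[1].
    apply: le_valuation_horner; last by rewrite valuation1.
    move=> i; have [ip|ip] := ltnP i (size p); last first.
      by rewrite nth_default // valuation0 lei_Infty.
    have := le_q i; rewrite vq // gamma_eq0 FinMn mul0rn.
    by rewrite -[X in _ <= X]/(_ + 0) addr0.
  by rewrite pE mulr1 -rmorphD addrC subrK leNgt fb_lt.
(* The values of [l] are the candidates for [c]; the representatives are numerous enough to
   outnumber the exceptions of [q] and [l] together. *)
pose l := a%:P + ((b - a) * t) *: 'X.
have [us [sz_us us0 us_pw]] :=
  residue_representatives (size q + size l) res_inf.
have q_bad : (count (fun u => Fin alpha < vL q.[iota u])%R us < size q)%N.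
  have := @size_lt_valuation_horner _ _ vL (Fin alpha) (map iota us) q i isT.
  rewrite count_map; apply=> //.
    by rewrite all_map; under eq_all do rewrite /= v_ext.
  rewrite pairwise_map; apply: sub_pairwise us_pw => x y.
  by rewrite /= -rmorphB v_ext.
have l_bad : (count (fun u => vK a < vK l.[u])%R us <= size l)%N.
  (* For [a = 0] the bound is [Infty] and nothing exceeds it; otherwise it is finite and is the
     value of the constant coefficient of [l]. *)
  have [a0|a0] := eqVneq a 0.
    rewrite (eq_count (a2 := pred0)) ?count_pred0 // => u.
    by rewrite a0 valuation0 ltNge lei_Infty.
  apply/ltnW/(@size_lt_valuation_horner _ _ vK (vK a) us l 0%N) => //.
    case e: (vK a) => //; move/valuation_infty: e => e.
    by rewrite e eqxx in a0.
  by rewrite coefD coefC coefZ coefX mulr0 addr0.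
pose bad_q u := Fin alpha < vL q.[iota u]; pose bad_l u := vK a < vK l.[u].
pose bad := predU bad_q bad_l.
have few_bad : (count bad us < size us)%N.
  apply: leq_ltn_trans (leq_addr (count (predI bad_q bad_l) us) _) _.
  by rewrite count_predUI sz_us -addSn leq_add.
have [u u_us /norP[]] : exists2 u, u \in us & ~~ bad u.
  by apply/hasP; rewrite (has_predC bad) all_count neq_ltn few_bad.
rewrite -!leNgt => qu lu.
have u0 := allP us0 u u_us.
have cE : l.[u] = a + (b - a) * t * u by rewrite !hornerE.
exists l.[u]; split.
  apply: le_anti; rewrite -{1 2}[f.[_]](_ : q.[iota u] = _).
    rewrite qu le_valuation_horner //= v_ext //.
  by rewrite qE pE cE mulrA !(rmorphD, rmorphM).
rewrite le_max lu orTb andbT cE.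
(* Since [t] and [u] are integral, [(b - a) * t * u] has value at least [vK (b - a)], hence at least
   the minimum. *)
apply: le_trans (valuationD vK _ _); rewrite le_min ge_min lexx /=.
rewrite !valuationM vt -addrA.
apply: le_trans (lei_addr _ (lei_add gamma0 u0)).
by rewrite minC -(valuationN _ a); apply: valuationD.
Qed.
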